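(* Let $n,\ell,\bar k\ge1$ be integers, let $J_1,\dots,J_\ell$ be nonempty subsets of $\{1,\dots,n\}$, let $K_1,\dots,K_\ell\subset\{1,\dots,\bar k\}$, and let $g_1,\dots,g_{\bar k}\in\mathbb R[x_1,\dots,x_n]$ be such that $g_i$ depends only on the variables $\{x_k\}_{k\in J_j}$ whenever $i\in K_j$. Suppose the Łojasiewicz-type inequalities $$\operatorname{dist}(x,S(\mathbf g_{K_j}))^{\mathsf L_j}\le-\mathsf c_j\min\big(\{0\}\cup\{g_i(x):i\in K_j\}\big),\qquad x\in[-1,1]^n,\ j=1,\dots,\ell,$$ hold with some constants $\mathsf c_j\ge1$ and with exponents $\mathsf L_1=\dots=\mathsf L_\ell=1$. Let $C,C''>0$ be constants, let $J_j$ be a largest of the sets $J_1,\dots,J_\ell$, and for $\varepsilon>0$ set $$B_{\mathrm{dense}}(\varepsilon)=\binom{n+C\varepsilon^{-1/2}}{C\varepsilon^{-1/2}},\qquad B_{\mathrm{sparsePut}}(\varepsilon)=\binom{|J_j|\big(1+C''\varepsilon^{-\frac{26}{3}-\frac53|J_j|}\big)}{|J_j|\,C''\varepsilon^{-\frac{26}{3}-\frac53|J_j|}}.$$ If $\frac n2>|J_i|\left(\frac{26}{3}+\frac53|J_i|\right)$ for all $i=1,\dots,\ell$, then $$\lim_{\varepsilon\searrow0}\frac{B_{\mathrm{sparsePut}}(\varepsilon)}{B_{\mathrm{dense}}(\varepsilon)}=0.$$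
   Context: $S(\mathbf g_{K_j})=\{x\in\mathbb R^n:g_i(x)\ge0\ \forall i\in K_j\}$, and $\operatorname{dist}$ is Euclidean distance. Binomial coefficients with real entries are understood via the Gamma function: $\binom{a+t}{t}=\frac{\Gamma(a+t+1)}{\Gamma(a+1)\Gamma(t+1)}$ for real $a,t\geq 0$. *)

(* Defs.v *)
(* mpoly is required without Import: its notations clash with those of
   mathcomp-analysis. *)
From mathcomp Require Import all_boot all_order all_algebra.
From mathcomp Require Import all_classical all_reals all_analysis.
From mathcomp Require mpoly.
Set Implicit Arguments.
Unset Strict Implicit.
Unset Printing Implicit Defensive.
Import Order.TTheory GRing.Theory Num.Theory.
Import numFieldNormedType.Exports.
Local Open Scope classical_set_scope.
Local Open Scope ring_scope.

(* Euler's integral; only meaningful for 0 < x (the integral diverges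
   otherwise, and Gamma x is then 0). *)
Definition Gamma (R : realType) (x : R) : R :=
  \int[lebesgue_measure]_(t in `]0, +oo[) (t `^ (x - 1) * expR (- t)).

(* "b choose t" for real b >= t >= 0; with b = a + t this is
   Gamma(a + t + 1) / (Gamma(a + 1) Gamma(t + 1)). *)
Definition rbinom (R : realType) (b t : R) : R :=
  Gamma (b + 1) / (Gamma (b - t + 1) * Gamma (t + 1)).

(* The norm that the library puts on 'rV[R]_n is the sup norm, hence this
   definition. *)
Definition eucl_dist (R : realType) (n : nat) (x y : 'rV[R]_n) : R :=
  Num.sqrt (\sum_(k < n) (x ord0 k - y ord0 k) ^+ 2).

(* Extended-real valued: the distance to the empty set is +oo. *)
Definition dist_set (R : realType) (n : nat) (x : 'rV[R]_n)
    (A : set 'rV[R]_n) : \bar R :=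
  ereal_inf [set (eucl_dist x y)%:E | y in A].

Definition mpeval (R : realType) (n : nat) (p : mpoly.mpoly n R)
    (x : 'rV[R]_n) : R :=
  mpoly.meval (fun k => x ord0 k) p.

(* p belongs to the polynomial subring R[x_k : k in J]. *)
Definition depends_only_on (R : realType) (n : nat) (p : mpoly.mpoly n R)
    (J : {set 'I_n}) : Prop :=
  forall m : mpoly.multinom n, mpoly.mcoeff m p != 0 ->
    forall k : 'I_n, k \notin J -> mpoly.fun_of_multinom m k = 0%N.

Definition semialg (R : realType) (n kbar : nat)
    (g : 'I_kbar -> mpoly.mpoly n R) (K : {set 'I_kbar}) : set 'rV[R]_n :=
  [set x | forall i, i \in K -> 0 <= mpeval (g i) x].

Definition B_dense (R : realType) (n : nat) (C eps : R) : R :=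
  rbinom (n%:R + C * eps `^ (- (1 / 2))) (C * eps `^ (- (1 / 2))).

(* d stands for the cardinality of a largest block of variables. *)
Definition B_sparsePut (R : realType) (d : nat) (C eps : R) : R :=
  let s := C * eps `^ (- (26 / 3) - 5 / 3 * d%:R) in
  rbinom (d%:R * (1 + s)) (d%:R * s).

(* Main.v *)
(* For a natural number m >= 1 the functional equation of Gamma gives
   rbinom (m + t) t = (t + 1) ... (t + m) / Gamma (m + 1), which lies between
   t^m / Gamma (m + 1) and (m + t)^m / Gamma (m + 1).  Hence B_sparsePut is
   O(eps^(-d (26/3 + 5/3 d))) and B_dense is at least a constant times
   eps^(-n/2).  Their ratio is O(eps^q) with q = n/2 - d (26/3 + 5/3 d) > 0. *)
Require Import Defs.
From mathcomp Require Import all_boot all_order all_algebra.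
From mathcomp Require Import all_classical all_reals all_analysis.
From mathcomp Require mpoly.
From mathcomp Require Import measurable_realfun ring lra.
Set Implicit Arguments.
Unset Strict Implicit.
Unset Printing Implicit Defensive.
Import Order.TTheory GRing.Theory Num.Theory.
Import numFieldNormedType.Exports.
Local Open Scope classical_set_scope.
Local Open Scope ring_scope.

(** * Decaying exponentials on half-lines *)

Lemma is_derive_expRNM (R : realType) (k x : R) :
  is_derive x 1 (fun t => expR (- (k * t))) (- (k * expR (- (k * x)))).
Proof.
have d : is_derive x 1 (fun t => - (k * t)) (- k).
  have := is_deriveN (is_deriveZ k (is_derive_id x (1 : R))).
  by rewrite [k *: _]mulr1; apply.
have := @is_derive1_comp _ _ (fun t => - (k * t)) _ _ _ (is_derive_expR _) d.
by rewrite mulrN mulrC; apply.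
Qed.

Lemma cvgy_expRNM (R : realType) (k : R) : 0 < k ->
  expR (- (k * x)) @[x --> +oo] --> (0 : R).
Proof.
move=> k0; apply: (@cvg_comp _ _ _ (fun x => k * x) (fun z => expR (- z)) _
  (pinfty_nbhs R)); last exact: cvgr_expR.
exact: gt0_cvgMry.
Qed.

Lemma integral_expRNM (R : realType) (k a : R) : 0 < k ->
  (\int[lebesgue_measure]_(x in `[a, +oo[) (expR (- (k * x)))%:E
    = (expR (- (k * a)) / k)%:E)%E.
Proof.
move=> k0; pose F x := - (k^-1 * expR (- (k * x))).
have dF x : is_derive x (1 : R) F (expR (- (k * x))).
  rewrite [X in is_derive _ _ _ X](_ : _
    = - (k^-1 *: - (k * expR (- (k * x))))).
    by apply: is_deriveN; apply: is_deriveZ; exact: is_derive_expRNM.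
  by rewrite scalerN opprK [in RHS]/GRing.scale/= mulKf ?gt_eqF.
have cF x : {for x, continuous F}.
  by apply/differentiable_continuous/derivable1_diffP; case: (dF x).
rewrite (@ge0_continuous_FTC2y _ _ F _ 0).
- by rewrite /F EFinN oppeK add0e mulrC.
- by move=> x _; exact: expR_ge0.
- apply: continuous_subspaceT => x.
  apply/differentiable_continuous/derivable1_diffP.
  by case: (is_derive_expRNM k x).
- rewrite -[X in _ --> X]oppr0; apply: cvgN.
  by rewrite -(mulr0 k^-1); apply: cvgMr; exact: cvgy_expRNM.
- by move=> x _; case: (dF x).
- by apply: cvg_at_right_filter; exact: cF.
- by move=> x _; rewrite derive1E derive_val.
Qed.

(** * The integrand of Gamma: growth, continuity, integrability *)

Section Gamma_integrand.
Context {R : realType}.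
Implicit Types a t x : R.

Definition gint a t := t `^ a * expR (- t).

Lemma gint_ge0 a t : 0 <= gint a t.
Proof. by rewrite mulr_ge0 ?powR_ge0 ?expR_ge0. Qed.

(** Half of the exponential decay absorbs the power: u = t / (2 a) satisfies u <= 1 + u <= e^u, and
    raising this to the power a gives t^a <= (2 a)^a e^(t/2). The resulting majorant yields decay at
    infinity, integrability, and the constant [M] in [GammaS]. *)
Lemma gint_le a t : 0 < a -> 0 <= t ->
  gint a t <= (2 * a) `^ a * expR (- (2^-1 * t)).
Proof.
move=> a0 t0; have a20 : 0 < 2 * a by rewrite mulr_gt0.
have -> : expR (- (2^-1 * t)) = expR (2^-1 * t) * expR (- t).
  by rewrite -expRD; congr expR; field.
rewrite /gint mulrA ler_wpM2r ?expR_ge0//.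
have -> : 2^-1 * t = t / (2 * a) * a by field; rewrite gt_eqF.
rewrite expRM -powRM ?expR_ge0 ?(ltW a20)//.
apply: ge0_ler_powR; rewrite ?nnegrE ?mulr_ge0 ?expR_ge0 ?(ltW a0)//.
rewrite mulrC -ler_pdivrMr//; apply: le_trans (expR_ge1Dx _).
by rewrite lerDr.
Qed.

Lemma is_derive_gint a t : 0 < t ->
  is_derive t 1 (gint a) (a * gint (a - 1) t - gint a t).
Proof.
move=> t0.
have dE : is_derive t 1 (fun u : R => expR (- u)) (- expR (- t)).
  have := is_derive_expRNM 1 t; rewrite !mul1r.
  by under eq_fun do rewrite mul1r.
have -> : a * gint (a - 1) t - gint a t
    = t `^ a *: (- expR (- t)) + expR (- t) *: (a * t `^ (a - 1)).
  by rewrite /gint /GRing.scale/=; ring.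
have := is_deriveM (@is_derive1_powR _ a _ t0) dE; apply.
Qed.

Lemma cvg_gint0 a : 0 < a -> gint a t @[t --> 0^'+] --> gint a 0.
Proof.
move=> a0; rewrite /gint powR0 ?gt_eqF//; apply: cvgM; first exact: powR_cvg0.
apply: cvg_at_right_filter; apply: continuous_comp; first exact: opp_continuous.
exact: continuous_expR.
Qed.

Lemma continuous_gint a : 0 < a -> {within `[0, +oo[, continuous (gint a)}.
Proof.
move=> a0; apply/continuous_within_itvcyP; split; last exact: cvg_gint0.
move=> t; rewrite in_itv/= andbT => t0.
apply/differentiable_continuous/derivable1_diffP.
by case: (is_derive_gint a t0).
Qed.

Lemma cvgy_gint a : 0 < a -> gint a t @[t --> +oo] --> (0 : R).
Proof.
move=> a0.
apply: (@squeeze_cvgr _ _ _ _ (fun=> 0)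
  (fun t => (2 * a) `^ a * expR (- (2^-1 * t)))).
- near=> t; rewrite gint_ge0 gint_le//.
- exact: cvg_cst.
- rewrite -[X in _ --> X](mulr0 ((2 * a) `^ a)).
  by apply: cvgMr; exact: cvgy_expRNM.
Unshelve. all: by end_near. Qed.

Lemma measurable_gint a (D : set R) : measurable_fun D (gint a).
Proof.
apply: measurable_funM; first exact: measurableT_comp (measurable_powR _) _.
by apply: measurableT_comp => //; exact: measurable_funN.
Qed.

Lemma integrable_expRNM (k : R) : 0 < k ->
  lebesgue_measure.-integrable `[0, +oo[ (EFin \o (fun t => expR (- (k * t)))).
Proof.
move=> k0; apply/integrableP; split.
  apply/measurable_EFinP; apply: measurableT_comp => //.
  by apply: measurable_funN; exact: measurable_funM.
under eq_integral do rewrite /= ger0_norm ?expR_ge0//.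
by rewrite integral_expRNM// ltry.
Qed.

Lemma integrable_gint a : 0 < a ->
  lebesgue_measure.-integrable `[0, +oo[ (EFin \o gint a).
Proof.
move=> a0.
have half0 : (0 : R) < 2^-1 by rewrite invr_gt0.
have ib : lebesgue_measure.-integrable `[0, +oo[
    (EFin \o (fun t => (2 * a) `^ a * expR (- (2^-1 * t)))).
  exact: (integrableZl _ _ (integrable_expRNM half0)).
apply: le_integrable ib => //.
  by apply/measurable_EFinP; exact: measurable_gint.
move=> t /=; rewrite in_itv/= andbT => t0.
rewrite lee_fin !ger0_norm ?gint_ge0 ?mulr_ge0 ?powR_ge0 ?expR_ge0//.
exact: gint_le.
Qed.

End Gamma_integrand.

(** * Positivity and functional equation of Gamma *)

Lemma GammaE (R : realType) (a : R) : 0 < a ->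
  Gamma (a + 1) = \int[lebesgue_measure]_(t in `[0, +oo[) gint a t.
Proof.
(* The added endpoint 0 is a null set. For a > 0 the integrand is continuous up to 0, so the closed
   half-line suits the fundamental theorem of calculus. *)
move=> a0; rewrite /Gamma Rintegral_itv_obnd_cbnd addrK//.
apply: integrableS (integrable_gint a0) => // t /=.
by rewrite !in_itv/= !andbT => /ltW.
Qed.

(** For t >= 1 the factor t^a is at least 1, so the part of the integral over [1, +oo[ alone is at
    least that of e^(-t), which is e^(-1). *)
Lemma Gamma_gt0 (R : realType) (a : R) : 0 < a -> 0 < Gamma (a + 1).
Proof.
move=> a0; rewrite GammaE//; apply: lt_le_trans (expR_gt0 (- 1)) _.
(* Finiteness matters here: the real-valued integral would default to 0 if the extended one were
   infinite. *)
rewrite -lee_fin fineK; last exact: integrable_fin_num (integrable_gint a0).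
have := integral_expRNM 1 (@ltr01 R); rewrite mulr1 divr1 => <-.
apply: (@le_trans _ _
  (\int[lebesgue_measure]_(t in `[1%R, +oo[) (gint a t)%:E)%E).
  apply: ge0_le_integral => //.
  - apply/measurable_EFinP; apply: measurableT_comp => //.
    by apply: measurable_funN; exact: measurable_funM.
  - by apply/measurable_EFinP; exact: measurable_gint.
  - move=> t; rewrite /= in_itv/= andbT => t1; rewrite lee_fin /gint mul1r.
    by rewrite ler_peMl ?expR_ge0// -(powRr0 t) ler_powR// ltW.
apply: ge0_subset_integral => //.
- by apply/measurable_EFinP; exact: measurable_gint.
- by move=> t _; rewrite lee_fin gint_ge0.
- by move=> t /=; rewrite !in_itv/= !andbT; apply: le_trans.
Qed.

(* Integrating by parts means integrating the derivative of [- t^(a+1) e^-t],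
   which changes sign, while the fundamental theorem of calculus on a
   half-line is available for nonnegative integrands only.  Adding a large
   multiple of [e^(-t/2)] makes the derivative nonnegative. *)
Lemma GammaS (R : realType) (a : R) : 0 < a ->
  Gamma (a + 1 + 1) = (a + 1) * Gamma (a + 1).
Proof.
move=> a0; have a10 : 0 < a + 1 by rewrite addr_gt0.
(* By [gint_le], this [M] makes M e^(-t/2) dominate (a + 1) t^a e^(-t), so that [h] is nonnegative.
   The function [H] is an antiderivative of [h] on t > 0. *)
rewrite !GammaE//; set M := (a + 1) * (2 * a) `^ a.
pose E (t : R) := expR (- (2^-1 * t)).
pose h t := gint (a + 1) t + (M * E t - (a + 1) * gint a t).
pose H t := - gint (a + 1) t - 2 * M * E t.
have half0 : (0 : R) < 2^-1 by rewrite invr_gt0.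
have iE : lebesgue_measure.-integrable `[0, +oo[ (EFin \o E).
  exact: integrable_expRNM.
have iME : lebesgue_measure.-integrable `[0, +oo[ (EFin \o (fun t => M * E t)).
  exact: (integrableZl _ _ iE).
have ig := integrable_gint a0; have ig1 := integrable_gint a10.
have iag : lebesgue_measure.-integrable `[0, +oo[
    (EFin \o (fun t => (a + 1) * gint a t)).
  exact: (integrableZl _ _ ig).
have iD : lebesgue_measure.-integrable `[0, +oo[
    (EFin \o (fun t => M * E t - (a + 1) * gint a t)).
  exact: (integrableB _ iME iag).
have cE : continuous E.
  move=> t; apply/differentiable_continuous/derivable1_diffP.
  by case: (is_derive_expRNM 2^-1 t).
have dH (t : R) : 0 < t -> is_derive t 1 H (h t).
  move=> t0; have d1 := is_deriveN (is_derive_gint (a + 1) t0).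
  have d2 := is_deriveZ (2 * M) (is_derive_expRNM 2^-1 t).
  have := is_deriveB d1 d2; rewrite addrK.
  rewrite [X in is_derive _ _ _ X -> _](_ : _ = h t); first by apply.
  by rewrite /h /E /GRing.scale/=; field.
(* [H] tends to 0 at infinity and H(0) = - 2 M, because 0^(a+1) = 0. The auxiliary exponential
   contributes exactly the same 2 M, so it cancels once the integral of [h] is split by
   linearity. *)
have hE : \int[lebesgue_measure]_(t in `[0, +oo[) h t = M * 2.
  rewrite (@Rintegral_ge0_continuous_FTC2y _ h H 0 0).
  - rewrite /H /E /gint mulr0 oppr0 expR0 powR0 ?gt_eqF// mul0r; ring.
  - move=> t t0; rewrite addr_ge0 ?gint_ge0// subr_ge0 -mulrA ler_pM2l//.
    exact: gint_le.
  - have c1 := continuous_gint a10; have c0 := continuous_gint a0.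
    move=> t; apply: cvgD; first exact: c1.
    apply: cvgB; apply: cvgMr; last exact: c0.
    exact: (continuous_subspaceT cE).
  - have e0 : (0 : R) = - 0 - 2 * M * 0 by rewrite mulr0 subr0 oppr0.
    rewrite [X in _ --> X]e0.
    apply: cvgB; first by apply: cvgN; exact: cvgy_gint.
    by apply: cvgMr; exact: cvgy_expRNM.
  - by move=> t t0; case: (dH t t0).
  - apply: cvgB; first by apply: cvgN; exact: cvg_gint0.
    by apply: cvgMr; apply: cvg_at_right_filter; exact: cE.
  - move=> t; rewrite in_itv/= andbT => t0; rewrite derive1E.
    by case: (dH t t0).
move: hE; rewrite RintegralD// RintegralB// !RintegralZl//.
have -> : \int[lebesgue_measure]_(t in `[0, +oo[) E t = 2.
  by rewrite /Rintegral integral_expRNM//= mulr0 oppr0 expR0 invrK mul1r.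
by move=> hE; lra.
Qed.

(** * Binomials with a natural number as lower difference *)

Lemma Gamma_addn (R : realType) (m : nat) (t : R) : 0 < t ->
  Gamma (m%:R + t + 1) = \prod_(i < m) (t + i.+1%:R) * Gamma (t + 1).
Proof.
move=> t0; elim: m => [|m IH]; first by rewrite add0r big_ord0 mul1r.
rewrite big_ord_recr/= mulrAC -IH -[in LHS]natr1 [_ + 1 + t]addrAC GammaS.
  by rewrite mulrC -natr1; congr (_ * _); ring.
by rewrite ltr_wpDl.
Qed.

Lemma rbinom_addn (R : realType) (m : nat) (t : R) : 0 < t ->
  rbinom (m%:R + t) t = \prod_(i < m) (t + i.+1%:R) / Gamma (m%:R + 1).
Proof.
move=> t0; rewrite /rbinom addrK Gamma_addn// -mulf_div divff ?mulr1//.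
by rewrite gt_eqF ?Gamma_gt0.
Qed.

(** Each of the m factors t + 1, ..., t + m lies between t and m + t. *)
Lemma le_rbinom_addn (R : realType) (m : nat) (t : R) : (0 < m)%N -> 0 < t ->
  t ^+ m / Gamma (m%:R + 1) <= rbinom (m%:R + t) t
    <= (m%:R + t) ^+ m / Gamma (m%:R + 1).
Proof.
move=> m0 t0; have G0 : 0 < Gamma (m%:R + 1 : R) by rewrite Gamma_gt0 ?ltr0n.
rewrite rbinom_addn// !ler_pM2r ?invr_gt0//.
have cst (x : R) : x ^+ m = \prod_(i < m) x by rewrite prodr_const card_ord.
rewrite !cst; apply/andP; split; apply: ler_prod => i _.
  by rewrite ltW//= lerDl.
apply/andP; split; first exact: addr_ge0 (ltW t0) (ler0n _ _).
by rewrite addrC lerD2r ler_nat.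
Qed.

(** * Power bounds in eps and the limit *)

Lemma B_sparsePut_le (R : realType) (d : nat) (C eps : R) :
  (0 < d)%N -> 0 < C -> 0 < eps <= 1 ->
  0 <= B_sparsePut d C eps
    <= (d%:R * (1 + C)) ^+ d / Gamma (d%:R + 1)
       * eps `^ (- (d%:R * (26 / 3 + 5 / 3 * d%:R))).
Proof.
move=> d0 C0 /andP[eps0 eps1]; have dR : (0 : R) < d%:R by rewrite ltr0n.
have G0 : 0 < Gamma (d%:R + 1 : R) by rewrite Gamma_gt0.
rewrite /B_sparsePut; set p := eps `^ (_ - _); set s := C * p.
have p1 : 1 <= p.
  by rewrite -(powRr0 eps) /p ger_powR ?eps0// -opprD oppr_le0.
have s0 : 0 < s by rewrite mulr_gt0 ?powR_gt0.
have ds0 : 0 < d%:R * s by rewrite mulr_gt0.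
rewrite mulrDr mulr1; have /andP[lo up] := le_rbinom_addn d0 ds0.
apply/andP; split.
  by apply: le_trans lo; rewrite divr_ge0 ?exprn_ge0 ?ltW.
apply: le_trans up _.
have -> : eps `^ (- (d%:R * (26 / 3 + 5 / 3 * d%:R))) = p ^+ d.
  by rewrite -powR_mulrn ?powR_ge0// -powRrM; congr (_ `^ _); ring.
have u0 : 0 <= d%:R + d%:R * s by rewrite addr_ge0 ?ltW.
(* Since eps <= 1 and the exponent is nonpositive, p >= 1, so the additive d is absorbed into d
   p. *)
have le_u : d%:R + d%:R * s <= d%:R * (1 + C) * p.
  by rewrite -mulrA mulrDl mul1r mulrDr lerD2r ler_peMr ?(ltW dR).
rewrite mulrAC ler_pM2r ?invr_gt0// -exprMn.
by rewrite lerXn2r ?nnegrE ?(le_trans u0 le_u).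
Qed.

Lemma B_dense_ge (R : realType) (n : nat) (C eps : R) :
  (0 < n)%N -> 0 < C -> 0 < eps ->
  C ^+ n / Gamma (n%:R + 1) * eps `^ (- (n%:R / 2)) <= B_dense n C eps.
Proof.
move=> n0 C0 eps0; set p := eps `^ (- (1 / 2)).
have p0 : 0 < C * p by rewrite mulr_gt0 ?powR_gt0.
have /andP[+ _] := le_rbinom_addn n0 p0; apply: le_trans.
have -> : eps `^ (- (n%:R / 2)) = p ^+ n.
  by rewrite -powR_mulrn ?powR_ge0// -powRrM; congr (_ `^ _); field.
by rewrite mulrAC -exprMn.
Qed.

Theorem proposition5 (R : realType) (n l kbar : nat)
  (n_ge1 : (1 <= n)%N) (l_ge1 : (1 <= l)%N) (kbar_ge1 : (1 <= kbar)%N)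
  (J : 'I_l -> {set 'I_n}) (J_neq0 : forall j, J j != finset.set0)
  (K : 'I_l -> {set 'I_kbar})
  (g : 'I_kbar -> mpoly.mpoly n R)
  (g_sparse : forall j i, i \in K j -> depends_only_on (g i) (J j))
  (c L : 'I_l -> R)
  (c_ge1 : forall j, 1 <= c j)
  (L_eq1 : forall j, L j = 1)
  (lojasiewicz : forall (j : 'I_l) (x : 'rV[R]_n),
     (forall k, -1 <= x ord0 k <= 1) ->
     (poweR (dist_set x (semialg g (K j))) (L j)
        <= (- c j * \big[Num.min/0]_(i in K j) mpeval (g i) x)%:E)%E)
  (C C'' : R) (C_gt0 : 0 < C) (C''_gt0 : 0 < C'')
  (j : 'I_l) (j_largest : forall i, (#|J i| <= #|J j|)%N)
  (n_large : forall i,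
     #|J i|%:R * (26 / 3 + 5 / 3 * #|J i|%:R) < n%:R / 2 :> R) :
  B_sparsePut #|J j| C'' eps / B_dense n C eps @[eps --> 0^'+] --> (0 : R).
Proof.
set d := #|J j|; have d0 : (0 < d)%N by rewrite card_gt0.
set e : R := d%:R * (26 / 3 + 5 / 3 * d%:R).
(* The dimension hypothesis, taken at the largest block, makes the exponent of the final bound
   positive. *)
have q0 : 0 < n%:R / 2 - e by rewrite subr_gt0 n_large.
set A := (d%:R * (1 + C'')) ^+ d / Gamma (d%:R + 1).
set D := C ^+ n / Gamma (n%:R + 1).
have D0 : 0 < D by rewrite divr_gt0 ?exprn_gt0 ?Gamma_gt0 ?ltr0n.
(* The majorant is the upper bound of the numerator divided by the lower bound of the
   denominator. *)
apply: (@squeeze_cvgr _ _ _ _ (fun=> 0)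
  (fun eps => A / D * eps `^ (n%:R / 2 - e))); last 2 first.
- exact: cvg_cst.
- by rewrite -[X in _ --> X](mulr0 (A / D)); apply: cvgMr; exact: powR_cvg0.
near=> eps.
have eps0 : 0 < eps by near: eps; exact: nbhs_right_gt.
have eps1 : eps <= 1 by near: eps; exact: nbhs_right_le.
have /andP[S0 Sle] : 0 <= B_sparsePut d C'' eps <= A * eps `^ (- e).
  by apply: B_sparsePut_le; rewrite ?eps0.
have Dge := B_dense_ge n_ge1 C_gt0 eps0; rewrite -/D in Dge.
have Dp0 : 0 < D * eps `^ (- (n%:R / 2)) by rewrite mulr_gt0 ?powR_gt0.
have B0 := lt_le_trans Dp0 Dge.
rewrite divr_ge0 ?(ltW B0)//= ler_pdivrMr//; apply: le_trans Sle _.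
have A0 : 0 <= A.
  by rewrite divr_ge0 ?exprn_ge0 ?mulr_ge0 ?addr_ge0 ?(ltW C''_gt0)// ltW
    ?Gamma_gt0 ?ltr0n.
have -> : A * eps `^ (- e)
    = A / D * eps `^ (n%:R / 2 - e) * (D * eps `^ (- (n%:R / 2))).
  rewrite mulrACA divfK ?gt_eqF// -powRD ?(gt_eqF eps0) ?implybT//.
  by rewrite addrAC subrr add0r.
by apply: ler_wpM2l => //; rewrite mulr_ge0 ?powR_ge0 ?(divr_ge0 A0 (ltW D0)).
Unshelve. all: by end_near. Qed.
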